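(* Let $1\le p,q\le\infty$ with $\frac1p+\frac1q\le1$, let $X_1,\dots,X_n,Y$ be Banach spaces and let $\beta$ be a reasonable crossnorm on $X_1\otimes\dots\otimes X_n$. Then: (i) $D_{p,q}^\beta(\varphi\cdot y)\le\|\varphi\|_\beta\|y\|$ for all $\varphi\in\mathcal L^\beta(X_1,\dots,X_n)$ and $y\in Y$, where $\varphi\cdot y$ is the multilinear operator $(x^1,\dots,x^n)\mapsto\varphi(x^1,\dots,x^n)\,y$. (ii) $Lip^\beta(f_T)\le D_{p,q}^\beta(T)$ for all $T\in\mathcal D_{p,q}^\beta(X_1,\dots,X_n;Y)$. (iii) Let $Z_1,\dots,Z_n,W$ be Banach spaces and let $\theta$ be a reasonable crossnorm on $Z_1\otimes\dots\otimes Z_n$. Let $R:Z_1\times\dots\times Z_n\to(X_1\otimes\dots\otimes X_n,\beta)$ be a bounded multilinear operator such that its linearization $\widetilde R:(Z_1\otimes\dots\otimes Z_n,\theta)\to(X_1\otimes\dots\otimes X_n,\beta)$ is bounded and $f_R(\Sigma_{Z_1\dots Z_n})\subset\Sigma_{X_1\dots X_n}$, let $T\in\mathcal D_{p,q}^\beta(X_1,\dots,X_n;Y)$ and let $S:Y\to W$ be a bounded linear operator. Then $Sf_TR$ belongs to $\mathcal D_{p,q}^\theta(Z_1,\dots,Z_n;W)$ and $D_{p,q}^\theta(Sf_TR)\le\|\widetilde R\|\,D_{p,q}^\beta(T)\,\|S\|$.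
   Context: All Banach spaces are over the same field $\mathbb K\in\{\mathbb R,\mathbb C\}$; $s^*$ is the conjugate exponent of $s\in[1,\infty]$; $B_X$ is the closed unit ball. A norm $\beta$ on the algebraic tensor product $X_1\otimes\dots\otimes X_n$ is a reasonable crossnorm if $\varepsilon(u)\le\beta(u)\le\pi(u)$ for all $u$, where $\varepsilon$ and $\pi$ are the injective and projective tensor norms. $\Sigma_{X_1\dots X_n}=\{x^1\otimes\dots\otimes x^n:x^i\in X_i\}$, with the metric induced by $\beta$. For a multilinear operator $T$, $\widetilde T$ denotes its linearization on the tensor product and $f_T$ the restriction of $\widetilde T$ to the decomposable tensors: $f_T(x^1\otimes\dots\otimes x^n)=T(x^1,\dots,x^n)$. $Lip^\beta(f_T)$ is the Lipschitz constant of $f_T$ on $\Sigma_{X_1\dots X_n}$ with respect to the metric $\beta(a-b)$. $\mathcal L^\beta(X_1,\dots,X_n)$ is the Banach space of multilinear forms $\varphi$ whose linearization $\widetilde\varphi:(X_1\otimes\dots\otimes X_n,\beta)\to\mathbb K$ is bounded, with norm $\|\varphi\|_\beta=\|\widetilde\varphi\|$. For finite sequences, $\|(x_i^1\otimes\dots\otimes x_i^n-z_i^1\otimes\dots\otimes z_i^n)_{i=1}^m\|_p^{w,\beta}=\sup_{\varphi\in B_{\mathcal L^\beta(X_1,\dots,X_n)}}\big(\sum_i|\varphi(x_i^1,\dots,x_i^n)-\varphi(z_i^1,\dots,z_i^n)|^p\big)^{1/p}$ and $\|(y_i^* )_{i=1}^m\|_q^w=\sup_{y^{**}\in B_{Y^{**}}}\big(\sum_i|y^{**}(y_i^*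 )|^q\big)^{1/q}$ (maxima over $i$ if the exponent is $\infty$). Let $r\in[1,\infty]$ be determined by $1=\frac1r+\frac1p+\frac1q$. A multilinear $T:X_1\times\dots\times X_n\to Y$ is $\beta$-$(p,q)$-dominated if there is $C>0$ with $$\|(\langle y_i^*,T(x_i^1,\dots,x_i^n)-T(z_i^1,\dots,z_i^n)\rangle)_{i=1}^m\|_{r^*}\le C\,\|(x_i^1\otimes\dots\otimes x_i^n-z_i^1\otimes\dots\otimes z_i^n)_{i=1}^m\|_p^{w,\beta}\,\|(y_i^* )_{i=1}^m\|_q^w$$ for all finite sequences $(x_i^1,\dots,x_i^n)_{i=1}^m,(z_i^1,\dots,z_i^n)_{i=1}^m$ in $X_1\times\dots\times X_n$ and $(y_i^* )_{i=1}^m$ in $Y^*$; $D_{p,q}^\beta(T)$ is the infimum of such $C$, and $\mathcal D_{p,q}^\beta(X_1,\dots,X_n;Y)$ is the set of all such operators. *)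

(* Defs.v *)
From HB Require Import structures.
From mathcomp Require Import all_boot all_order all_algebra.
From mathcomp Require Import generic_quotient complex.
From mathcomp Require Import all_classical all_reals all_analysis.

Set Implicit Arguments.
Unset Strict Implicit.
Unset Printing Implicit Defensive.

Import Order.TTheory GRing.Theory Num.Theory.
Import numFieldNormedType.Exports.

Local Open Scope classical_set_scope.
Local Open Scope ring_scope.
Local Open Scope quotient_scope.

(* The algebraic tensor product of X_0, ..., X_(n-1): finite formal sums of   *)
(* c * (x_0, ..., x_(n-1)), where two formal sums are identified when every   *)
(* multilinear map takes the same value on both.  The lemmas below give the   *)
(* universal property and the spanning by elementary tensors.                 *)
Section AlgebraicTensor.
Variables (K : fieldType) (n : nat) (X : 'I_n -> lmodType K).
Implicit Type V : lmodType K.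

Definition multilinear V (T : (forall i, X i) -> V) : Prop :=
  forall (x : forall i, X i) (i : 'I_n) (a : K) (u v : X i),
    T (dfwith x i (a *: u + v)) = a *: T (dfwith x i u) + T (dfwith x i v).

Definition formal_sum := seq (K * (forall i, X i))%type.

HB.instance Definition _ := Choice.on formal_sum.

Definition formal_eval V (T : (forall i, X i) -> V) (s : formal_sum) : V :=
  \sum_(t <- s) t.1 *: T t.2.

Definition formal_eq (s t : formal_sum) : bool :=
  `[< forall V (T : (forall i, X i) -> V), multilinear T ->
        formal_eval T s = formal_eval T t >].

Lemma formal_eq_refl : reflexive formal_eq.
Proof. by move=> s; apply/asboolP. Qed.

Lemma formal_eq_sym : symmetric formal_eq.
Proof.
move=> s t; apply/idP/idP => /asboolP st; apply/asboolP => V T mT;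
  by rewrite st.
Qed.

Lemma formal_eq_trans : transitive formal_eq.
Proof.
move=> t s r /asboolP st /asboolP tr; apply/asboolP => V T mT.
by rewrite st // tr.
Qed.

Definition formal_equiv :=
  EquivRel formal_eq formal_eq_refl formal_eq_sym formal_eq_trans.

Definition tensor := {eq_quot formal_equiv}.

HB.instance Definition _ := Choice.on tensor.

Definition tens (x : forall i, X i) : tensor := \pi_tensor [:: (1, x)].

(* Meaningful for multilinear T only: otherwise the value depends on the      *)
(* chosen representative.                                                     *)
Definition linearize V (T : (forall i, X i) -> V) (u : tensor) : V :=
  formal_eval T (repr u).

Lemma linearize_pi V (T : (forall i, X i) -> V) s :
  multilinear T -> linearize T (\pi_tensor s) = formal_eval T s.
Proof.
move=> mT; rewrite /linearize.
have : formal_equiv (repr (\pi_tensor s)) s.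
  by apply/(@eqmodP _ formal_equiv); rewrite reprK.
by move/asboolP => /(_ V T mT).
Qed.

Lemma tensor_ext (u v : tensor) :
  (forall V (T : (forall i, X i) -> V), multilinear T ->
     linearize T u = linearize T v) -> u = v.
Proof.
move=> uv; rewrite -(reprK u) -(reprK v).
by apply/(@eqmodP _ formal_equiv)/asboolP => V T mT; exact: uv.
Qed.

Definition tensor_zero : tensor := \pi_tensor [::].
Definition tensor_add (u v : tensor) : tensor :=
  \pi_tensor (repr u ++ repr v : formal_sum).
Definition tensor_scale (a : K) (u : tensor) : tensor :=
  \pi_tensor [seq (a * t.1, t.2) | t <- repr u].
Definition tensor_opp (u : tensor) : tensor := tensor_scale (- 1) u.

Section Eval.
Variables (V : lmodType K) (T : (forall i, X i) -> V).
Hypothesis mT : multilinear T.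

Lemma linearize_zero : linearize T tensor_zero = 0.
Proof. by rewrite linearize_pi // /formal_eval big_nil. Qed.

Lemma linearize_add u v :
  linearize T (tensor_add u v) = linearize T u + linearize T v.
Proof. by rewrite linearize_pi // /formal_eval big_cat. Qed.

Lemma linearize_scale a u :
  linearize T (tensor_scale a u) = a *: linearize T u.
Proof.
rewrite linearize_pi // /formal_eval big_map scaler_sumr.
by apply: eq_bigr => t _; rewrite scalerA.
Qed.

Lemma linearize_opp u : linearize T (tensor_opp u) = - linearize T u.
Proof. by rewrite linearize_scale scaleN1r. Qed.

End Eval.

Local Lemma tensor_addA : associative tensor_add.
Proof. by move=> u v w; apply: tensor_ext => V T mT; rewrite !linearize_add // addrA. Qed.
Local Lemma tensor_addC : commutative tensor_add.
Proof. by move=> u v; apply: tensor_ext => V T mT; rewrite !linearize_add // addrC. Qed.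
Local Lemma tensor_add0 : left_id tensor_zero tensor_add.
Proof.
move=> u; apply: tensor_ext => V T mT.
by rewrite linearize_add // linearize_zero // add0r.
Qed.
Local Lemma tensor_addN : left_inverse tensor_zero tensor_opp tensor_add.
Proof.
move=> u; apply: tensor_ext => V T mT.
by rewrite linearize_add // linearize_opp // linearize_zero // addNr.
Qed.

HB.instance Definition _ := GRing.isZmodule.Build tensor
  tensor_addA tensor_addC tensor_add0 tensor_addN.

Local Lemma tensor_scaleA a b (u : tensor) :
  tensor_scale a (tensor_scale b u) = tensor_scale (a * b) u.
Proof. by apply: tensor_ext => V T mT; rewrite !linearize_scale // scalerA. Qed.
Local Lemma tensor_scale1 : left_id 1 tensor_scale.
Proof. by move=> u; apply: tensor_ext => V T mT; rewrite linearize_scale // scale1r. Qed.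
Local Lemma tensor_scaleDr : right_distributive tensor_scale +%R.
Proof.
move=> a u v; apply: tensor_ext => V T mT.
by rewrite linearize_scale // !linearize_add // !linearize_scale // scalerDr.
Qed.
Local Lemma tensor_scaleDl (u : tensor) :
  {morph tensor_scale^~ u : a b / a + b}.
Proof.
move=> a b; apply: tensor_ext => V T mT.
by rewrite linearize_scale // linearize_add // !linearize_scale // scalerDl.
Qed.

HB.instance Definition _ := GRing.Zmodule_isLmodule.Build K tensor
  tensor_scaleA tensor_scale1 tensor_scaleDr tensor_scaleDl.

Lemma linearize_linear V (T : (forall i, X i) -> V) :
  multilinear T -> linear (linearize T).
Proof. by move=> mT a u v; rewrite linearize_add // linearize_scale. Qed.

Lemma linearize_tens V (T : (forall i, X i) -> V) x :
  multilinear T -> linearize T (tens x) = T x.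
Proof. by move=> mT; rewrite linearize_pi // /formal_eval big_seq1 scale1r. Qed.

Lemma tens_multilinear : multilinear tens.
Proof.
move=> x i a u v; apply: tensor_ext => V T mT.
by rewrite linearize_add // linearize_scale // !linearize_tens.
Qed.

Lemma tensor_span (u : tensor) : u = \sum_(t <- repr u) t.1 *: tens t.2.
Proof.
apply: tensor_ext => V T mT; rewrite {1}/linearize /formal_eval.
elim: (repr u) => [|t s IHs]; first by rewrite !big_nil linearize_zero.
by rewrite !big_cons linearize_add // linearize_scale // linearize_tens // IHs.
Qed.

(* The set written Sigma_{X_1 ... X_n}. *)
Definition decomposable : set tensor := range tens.

End AlgebraicTensor.

Arguments decomposable {K n} X.

Inductive scalars := RealScalars | ComplexScalars.

Definition scalar_field (R : realType) (k : scalars) : numFieldType :=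
  match k with
  | RealScalars => R : numFieldType
  | ComplexScalars => R[i] : numFieldType
  end.

(* Norms in a normedModType K take values in K; when K = R[i] those values    *)
(* are real, and to_real reads them as elements of R.                         *)
Definition to_real (R : realType) (k : scalars) : scalar_field R k -> R :=
  match k return scalar_field R k -> R with
  | RealScalars => fun a => a
  | ComplexScalars => fun a => complex.Re a
  end.

Section ToReal.
Variables (R : realType) (k : scalars).
Implicit Types a b : scalar_field R k.

Lemma to_real0 : to_real (0 : scalar_field R k) = 0.
Proof. by case: k. Qed.

Lemma to_realD a b : to_real (a + b) = to_real a + to_real b.
Proof. by case: k a b => //= -[a1 a2] [b1 b2]. Qed.

Lemma ler_to_real a b : a <= b -> to_real a <= to_real b.
Proof. by case: k a b => //= a b; rewrite lecE => /andP[]. Qed.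

Lemma to_realM a b : 0 <= a -> 0 <= b ->
  to_real (a * b) = to_real a * to_real b.
Proof.
case: k a b => //= -[a1 a2] [b1 b2]; rewrite !lecE /= => /andP[/eqP a20 _].
by move=> _; rewrite a20 mul0r subr0.
Qed.

End ToReal.

Section NormedSpaces.
Variables (R : realType) (k : scalars).
Local Notation K := (scalar_field R k).

Definition rnorm (V : normedZmodType K) (x : V) : R := to_real `|x|.

Lemma rnorm0 (V : normedZmodType K) : rnorm (0 : V) = 0.
Proof. by rewrite /rnorm normr0 to_real0. Qed.

Lemma rnorm_ge0 (V : normedZmodType K) (x : V) : 0 <= rnorm x.
Proof. by rewrite -(to_real0 R k) ler_to_real. Qed.

Lemma rnormD (V : normedZmodType K) (x y : V) :
  rnorm (x + y) <= rnorm x + rnorm y.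
Proof. by rewrite -to_realD ler_to_real // ler_normD. Qed.

Lemma rnormM (a b : K) : rnorm (a * b) = rnorm a * rnorm b.
Proof. by rewrite /rnorm normrM to_realM. Qed.

Definition is_norm (E : lmodType K) (N : E -> R) : Prop :=
  [/\ forall u, N u = 0 -> u = 0,
      forall (a : K) u, N (a *: u) = rnorm a * N u
    & forall u v, N (u + v) <= N u + N v].

Definition bounded_op (E F : lmodType K) (NE : E -> R) (NF : F -> R)
    (L : E -> F) : Prop :=
  exists C : R, forall u, NF (L u) <= C * NE u.

Definition op_norm (E F : lmodType K) (NE : E -> R) (NF : F -> R)
    (L : E -> F) : \bar R :=
  ereal_sup [set (NF (L u))%:E | u in [set u | NE u <= 1]].

Section Dual.
Variables (E : lmodType K) (N : E -> R).

Definition in_dual : {pred E -> K^o} :=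
  fun f => `[< linear f /\ bounded_op N (@rnorm K) f >].

Record dual := Dual {
  dual_fun :> E -> K^o;
  dual_subproof : dual_fun \in in_dual }.

HB.instance Definition _ := [isSub for dual_fun].
HB.instance Definition _ := [Choice of dual by <:].

Lemma in_dual_closed : submod_closed in_dual.
Proof.
split.
  apply/asboolP; split; first by move=> a u v; rewrite scaler0 addr0.
  by exists 0 => u; rewrite rnorm0 mul0r.
move=> a f g /asboolP[lf [C Cf]] /asboolP[lg [D Dg]]; apply/asboolP; split.
  move=> b u v; rewrite !fctE lf lg !scalerDr !scalerA (mulrC a).
  by rewrite addrACA.
exists (rnorm a * C + D) => u.
apply: (le_trans (rnormD _ _)); rewrite mulrDl lerD ?Dg //.
by rewrite [leLHS]rnormM -mulrA ler_wpM2l // rnorm_ge0.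
Qed.

HB.instance Definition _ :=
  GRing.SubChoice_isSubLmodule.Build K (E -> K^o) in_dual dual
    in_dual_closed.

(* op_norm is finite on the dual. *)
Definition dual_norm (f : dual) : R := fine (op_norm N (@rnorm K) f).

End Dual.

(* Only used with p >= 1; the value at -oo is junk. *)
Definition lp_norm (m : nat) (p : \bar R) (a : 'I_m -> K) : R :=
  match p with
  | r%:E => (\sum_(i < m) rnorm (a i) `^ r) `^ r^-1
  | +oo%E => \big[Num.max/0]_(i < m) rnorm (a i)
  | -oo%E => 0
  end.

(* The weak norm of a finite family in E^* : the supremum over B_{E^**}. *)
Definition weak_dual_norm (E : lmodType K) (N : E -> R) (m : nat)
    (q : \bar R) (y : 'I_m -> dual N) : \bar R :=
  ereal_sup [set (lp_norm q (fun i => g (y i)))%:E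
            | g in [set g : dual (@dual_norm E N) | dual_norm g <= 1]].

Section Tensors.
Variables (n : nat) (X : 'I_n -> completeNormedModType K).

Definition injective_norm (u : tensor X) : \bar R :=
  ereal_sup [set (rnorm (linearize
                   (fun x : forall i, X i => \prod_i f i (x i) : K^o) u))%:E
            | f in [set f : forall i, dual (@rnorm (X i))
                    | forall i, dual_norm (f i) <= 1]].

Definition projective_norm (u : tensor X) : \bar R :=
  ereal_inf [set (\sum_(x <- s) \prod_i rnorm (x i))%:E
            | s in [set s : seq (forall i, X i)
                    | u = \sum_(x <- s) tens x]].

Definition reasonable_crossnorm (beta : tensor X -> R) : Prop :=
  is_norm beta /\
  forall u, (injective_norm u <= (beta u)%:E <= projective_norm u)%E.

Variable beta : tensor X -> R.

Definition form_norm (phi : (forall i, X i) -> K^o) : \bar R :=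
  op_norm beta (@rnorm K) (linearize phi).

(* The space L^beta(X_1, ..., X_n). *)
Definition beta_form (phi : (forall i, X i) -> K^o) : Prop :=
  multilinear phi /\ bounded_op beta (@rnorm K) (linearize phi).

Definition weak_tensor_norm (m : nat) (p : \bar R)
    (x z : 'I_m -> forall i, X i) : \bar R :=
  ereal_sup [set (lp_norm p (fun j => phi (x j) - phi (z j)))%:E
            | phi in [set phi | beta_form phi /\ (form_norm phi <= 1)%E]].

(* The infimum is +oo when f is not Lipschitz. *)
Definition lipschitz_const (Y : completeNormedModType K) (f : tensor X -> Y) :
    \bar R :=
  ereal_inf [set L%:E | L in [set L : R | 0 <= L /\
    forall a b, decomposable X a -> decomposable X b ->
      rnorm (f a - f b) <= L * beta (a - b)]].

End Tensors.

Definition third_exponent (p q : \bar R) : \bar R :=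
  ((1 - p^-1 - q^-1)^-1)%E.

Lemma inve_ge1 (p : \bar R) : (1 <= p)%E ->
  exists2 a : R, (p^-1)%E = a%:E & 0 <= a <= 1.
Proof.
case: p => [p| |] //; last by exists 0; rewrite ?invey // lexx ler01.
rewrite lee_fin => p1; have p0 : 0 < p by exact: lt_le_trans p1.
exists p^-1; first by rewrite inver gt_eqF.
by rewrite invr_ge0 ltW //= invf_le1.
Qed.

Lemma third_exponentP (p q : \bar R) :
  (1 <= p -> 1 <= q -> p^-1 + q^-1 <= 1 ->
   1 <= third_exponent p q /\
   1 = (third_exponent p q)^-1 + p^-1 + q^-1)%E.
Proof.
move=> /inve_ge1[a pa /andP[a0 a1]] /inve_ge1[b qb /andP[b0 b1]].
rewrite /third_exponent pa qb -EFinD lee_fin => ab1.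
have -> : (1 - a%:E - b%:E = (1 - a - b)%:E)%E by [].
have c0 : 0 <= 1 - a - b by rewrite -addrA -opprD subr_ge0.
rewrite inver; case: eqP => [c00|/eqP cN0].
  by rewrite invey leey add0e -EFinD; split=> //; congr EFin; move/eqP: c00;
     rewrite -addrA -opprD subr_eq0 => /eqP.
have cp : 0 < 1 - a - b by rewrite lt_neqAle eq_sym cN0.
split.
  rewrite lee_fin invf_ge1 // -addrA -opprD gerBl addr_ge0 //.
rewrite inver invr_eq0 (negbTE cN0) invrK -!EFinD; congr EFin.
by rewrite addrAC !subrK.
Qed.

Section Dominated.
Variables (n : nat) (X : 'I_n -> completeNormedModType K).
Variables (Y : completeNormedModType K) (p q : \bar R) (beta : tensor X -> R).

Definition domination_const (T : (forall i, X i) -> Y) (C : R) : Prop :=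
  0 < C /\
  forall (m : nat) (x z : 'I_m -> forall i, X i) (y : 'I_m -> dual (@rnorm Y)),
    ((lp_norm (hoelder_conjugate (third_exponent p q))
              (fun j => y j (T (x j) - T (z j))))%:E
     <= C%:E * weak_tensor_norm beta p x z * weak_dual_norm q y)%E.

Definition dominated (T : (forall i, X i) -> Y) : Prop :=
  multilinear T /\ exists C, domination_const T C.

(* The infimum is +oo when T is not dominated. *)
Definition domination_norm (T : (forall i, X i) -> Y) : \bar R :=
  ereal_inf [set C%:E | C in domination_const T].

End Dominated.

Definition bounded_multilinear (n : nat) (Z : 'I_n -> completeNormedModType K)
    (E : lmodType K) (N : E -> R) (T : (forall i, Z i) -> E) : Prop :=
  multilinear T /\
  exists C : R, forall z, N (T z) <= C * \prod_i rnorm (z i).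

End NormedSpaces.

(* Main.v *)
From HB Require Import structures.
Require Import Defs.
From mathcomp Require Import all_boot all_order all_algebra.
From mathcomp Require Import complex ring lra.
From mathcomp Require Import all_classical all_reals all_analysis.

Set Implicit Arguments.
Unset Strict Implicit.
Unset Printing Implicit Defensive.

Import Order.TTheory GRing.Theory Num.Theory.
Import numFieldNormedType.Exports.

Local Open Scope classical_set_scope.
Local Open Scope ring_scope.

(* (i) is Hoelder's inequality for 1/r* = 1/p + 1/q, because evaluation at y  *)
(* is a functional of norm at most |y| on Y^* .  (ii) is the case m = 1 of the *)
(* domination inequality, tested on a functional y^* of norm at most 1 that    *)
(* attains the norm of T x - T z; it comes from the Hahn-Banach theorem.       *)
(* (iii) transports families: A maps decomposable tensors to decomposable      *)
(* ones, and composing with the linearization of A (resp. with the adjoint of  *)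
(* S) maps the unit ball of L^beta (resp. of Y^** ) into |A| (resp. |S|) times  *)
(* the unit ball of L^theta (resp. of W^** ).                                  *)

(** Let s be the conjugate of r, so that 1/s = 1/p + 1/q ([third_exponent_conjugate]). For
    [phi x *: y], pairing with a functional f splits a difference into [phi (x j) - phi (z j)] times
    [f j y]. Hoelder ([lp_norm_hoelder]) separates the two factors. Each is bounded by a norm times
    a weak norm ([form_le_weak_tensor_norm], [bidual_le_weak_dual_norm]), because a functional
    divided by a positive bound of its norm lies in the ball over which the weak norm is a supremum.

    For a single pair and a functional of norm at most 1, the weak norms are at most beta(x - z) and
    1 ([weak_tensor_norm_ord1], [weak_dual_norm_ord1]). Testing on a functional that norms T x - T z
    ([norming_functional]) shows that every domination constant is a Lipschitz constant.

    For compositions, moving S to its adjoint and writing each A(z) as an elementary tensor turns a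
    family for S T A into one for T. [weak_tensor_norm_comp] and [weak_dual_norm_comp] say how much
    its weak norms grow.

    The norming functional comes from the Hahn-Banach theorem, proved by minimal sublinear
    functionals over the reals and carried over to complex scalars. *)

Section Infimum.
Variable R : realType.
Implicit Types (A B : set R) (c t : R).

Lemma le_infD A B c : A !=set0 -> B !=set0 ->
  (forall a b, A a -> B b -> c <= a + b) -> c <= inf A + inf B.
Proof.
move=> A0 B0 cAB; rewrite -lerBlDr; apply: lb_le_inf => // a Aa.
rewrite lerBlDr -lerBlDl; apply: lb_le_inf => // b Bb.
by rewrite lerBlDl cAB.
Qed.

Lemma le_infM A c t : 0 < t -> A !=set0 ->
  (forall a, A a -> c <= t * a) -> c <= t * inf A.
Proof.
move=> t0 A0 cA; rewrite -ler_pdivrMl //; apply: lb_le_inf => // a Aa.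
by rewrite ler_pdivrMl ?cA.
Qed.

End Infimum.

Section HahnBanach.
Variables (R : realType) (V : lmodType R).
Implicit Types (s m : V -> R) (u v a : V) (t : R).

(** Homogeneity is asked as an inequality and for positive [t] only, a form that passes easily to
    infima. Equality follows by scaling back with the inverse of [t], and the value at 0 is then
    forced. *)
Definition sublinear s : Prop :=
  (forall u v, s (u + v) <= s u + s v) /\
  (forall t u, 0 < t -> s (t *: u) <= t * s u).

Lemma sublinear_homogeneous s t u : sublinear s -> 0 < t ->
  s (t *: u) = t * s u.
Proof.
move=> [_ sZ] t0; apply/eqP; rewrite eq_le sZ //=.
by rewrite -ler_pdivlMl // -{1}[u](scalerK (lt0r_neq0 t0)) sZ ?invr_gt0.
Qed.

Lemma sublinear0 s : sublinear s -> s 0 = 0.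
Proof.
move=> ss; have := sublinear_homogeneous 0 ss (ltr0n _ 2).
rewrite scaler0 mulr_natl mulr2n => /eqP.
by rewrite -subr_eq0 opprD addNKr oppr_eq0 => /eqP.
Qed.

Lemma sublinear_opp s u : sublinear s -> - s (- u) <= s u.
Proof.
by move=> ss; rewrite lerNl -subr_ge0 opprK -(sublinear0 ss) -(addNr u) ss.1.
Qed.

(** In a chain one of [m1], [m2] lies below the other, and the smaller one, being subadditive,
    bounds the infimum at [u + v] by [m1 u + m2 v]. The infima are genuine because every member is
    at least [- s (- u)] at [u]. *)
Lemma sublinear_inf (A : set (V -> R)) s : A !=set0 ->
  (forall m, A m -> sublinear m /\ forall u, m u <= s u) ->
  total_on A (fun m m' => `[< forall u, m' u <= m u >]) ->
  let i u := inf [set m u | m in A] in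
  sublinear i /\ forall m u, A m -> i u <= m u.
Proof.
move=> [m0 Am0] subA totA i.
have im m u : A m -> i u <= m u.
  move=> Am; apply: ge_inf; last by exists m.
  exists (- s (- u)) => _ [m' /subA [sm' m's] <-].
  by rewrite (le_trans _ (sublinear_opp u sm')) // lerN2.
have A0 u : [set m u | m in A] !=set0 by exists (m0 u), m0.
split=> //; split=> [u v|t u t0].
  apply: le_infD => // _ _ [m1 Am1 <-] [m2 Am2 <-].
  have [/asboolP m21|/asboolP m12] := totA _ _ Am1 Am2.
    by rewrite (le_trans (im _ _ Am2)) // (le_trans ((subA _ Am2).1.1 _ _)) ?lerD.
  by rewrite (le_trans (im _ _ Am1)) // (le_trans ((subA _ Am1).1.1 _ _)) ?lerD.
apply: le_infM => // _ [m Am <-].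
by rewrite (le_trans (im _ _ Am)) // (subA _ Am).1.2.
Qed.

(** Zorn's lemma on the sublinear functionals below [s], with the pointwise order reversed so that a
    maximal element is a minimal functional. A nonempty chain is bounded by its infimum, the empty
    one by [s]. *)
Lemma minimal_sublinear s : sublinear s -> exists m, [/\ sublinear m,
  forall u, m u <= s u
  & forall m', sublinear m' -> (forall u, m' u <= m u) -> m' = m].
Proof.
move=> ss; pose T := {m | sublinear m /\ forall u, m u <= s u}.
pose le (m m' : T) := `[< forall u, sval m' u <= sval m u >].
have [||||[m [sm ms]] min] := @Zorn T le.
- by move=> m; apply/asboolP.
- move=> m1 m2 m3 /asboolP m12 /asboolP m23; apply/asboolP => u.
  exact: le_trans (m23 u) (m12 u).
- move=> [m1 s1] [m2 s2] /asboolP m12 /asboolP m21.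
  have m1E : m1 = m2 by apply/funext => u; apply/eqP; rewrite eq_le m12 m21.
  by move: s2 m12 m21; rewrite -m1E => s2 _ _; rewrite (Prop_irrelevance s1 s2).
- move=> A totA; have [->|/set0P[m0 Am0]] := eqVneq A set0.
    by exists (exist _ s (conj ss (fun=> lexx _))).
  have [|||si im] := @sublinear_inf [set sval m | m in A] s.
  + by exists (sval m0), m0.
  + by move=> _ [[m sm] _ <-].
  + by move=> _ _ [m1 Am1 <-] [m2 Am2 <-]; exact: totA.
  + set i := fun u => _ in si im.
    have is_ u : i u <= s u.
      by rewrite (le_trans (im (sval m0) u _)) ?(svalP m0).2 //; exists m0.
    exists (exist _ i (conj si is_)) => m Am; apply/asboolP => u /=.
    by apply: im; exists m.
exists m; split=> // m' sm' m'm.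
have m's u : m' u <= s u by exact: le_trans (m'm u) (ms u).
suff /(congr1 sval) : exist _ m' (conj sm' m's) = exist _ m (conj sm ms) :> T.
  by [].
by apply: min; apply/asboolP.
Qed.

(** A sublinear functional below [s] (take [t = 0]) whose value at [- a] is at most [- s a] (take
    [t = 1]). A linear functional below it therefore takes the value [s a] at [a]. *)
Definition directional s a u : R :=
  inf [set s (u + t *: a) - t * s a | t in [set t | 0 <= t]].

Lemma directional_le s a u t : sublinear s -> 0 <= t ->
  directional s a u <= s (u + t *: a) - t * s a.
Proof.
move=> ss t0; apply: ge_inf; last by exists t.
(* The set is bounded below by [- s (- u)]: the number [r * s a] equals [s (- u + (u + r *: a))],
   which subadditivity splits. *)
exists (- s (- u)) => _ [r /= r0 <-]; rewrite lerBrDl.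
have -> : r * s a = s (- u + (u + r *: a)).
  rewrite addKr; move: r0; rewrite le_eqVlt => /predU1P[<-|r0].
    by rewrite mul0r scale0r sublinear0.
  by rewrite sublinear_homogeneous.
by rewrite lerBlDl ss.1.
Qed.

Lemma sublinear_directional s a : sublinear s -> sublinear (directional s a).
Proof.
move=> ss.
have s0 u : [set s (u + t *: a) - t * s a | t in [set t | 0 <= t]] !=set0.
  by exists (s (u + 0 *: a) - 0 * s a), 0 => /=.
split=> [u v|t u t0].
  apply: le_infD => // _ _ [t1 /= t10 <-] [t2 /= t20 <-].
  apply: (le_trans (directional_le a (u + v) ss (addr_ge0 t10 t20))).
  rewrite addrACA -opprD -mulrDl scalerDl addrACA lerD2r.
  exact: ss.1.
apply: le_infM => // _ [r /= r0 <-].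
apply: (le_trans (directional_le a _ ss (mulr_ge0 (ltW t0) r0))).
by rewrite mulrBr mulrA -scalerA -scalerDr lerD2r ss.2.
Qed.

(* A minimal sublinear functional [m] equals [directional m a] for every [a], *)
(* and the value at [t = 1] then makes [m] superadditive, hence linear.       *)
Lemma minimal_sublinear_linear m : sublinear m ->
  (forall m', sublinear m' -> (forall u, m' u <= m u) -> m' = m) ->
  linear (m : V -> R^o).
Proof.
move=> sm min.
have mD u v : m (u + v) = m u + m v.
  apply/eqP; rewrite eq_le sm.1 /= -lerBrDr.
  rewrite -{1}(min (directional m v)); last 2 first.
  - exact: sublinear_directional.
  - move=> w; apply: (le_trans (directional_le v w sm (lexx _))).
    by rewrite scale0r addr0 mul0r subr0.
  have := directional_le v u sm ler01.
  by rewrite scale1r mul1r.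
have mN u : m (- u) = - m u.
  by apply/eqP; rewrite -addr_eq0 -mD addNr sublinear0.
move=> t u v; rewrite mD; congr (_ + _).
have [t0|t0|->] := ltgtP t 0.
- rewrite -[t in LHS]opprK scaleNr mN sublinear_homogeneous ?oppr_gt0 //.
  by rewrite mulNr opprK.
- by rewrite sublinear_homogeneous.
- by rewrite !scale0r sublinear0.
Qed.

(** A minimal functional below [directional s a] is linear; minimising there rather than below [s]
    is what fixes its value at [a]. *)
Theorem real_hahn_banach s a : sublinear s ->
  exists f : V -> R, [/\ linear (f : V -> R^o), forall u, f u <= s u & f a = s a].
Proof.
move=> ss; have sd := sublinear_directional a ss.
have [f [sf fd fmin]] := minimal_sublinear sd.
have lf := minimal_sublinear_linear sf fmin.
have fs u : f u <= s u.
  apply: (le_trans (fd u)); apply: (le_trans (directional_le a u ss (lexx _))).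
  by rewrite scale0r addr0 mul0r subr0.
exists f; split=> //; apply/eqP; rewrite eq_le fs /=.
have fN : f (- a) = - f a.
  by have := lf (-1) a 0; rewrite !scaleN1r !addr0 (sublinear0 sf) addr0.
rewrite -lerN2 -fN (le_trans (fd _)) //.
apply: (le_trans (directional_le a (- a) ss ler01)).
by rewrite scale1r addNr mul1r (sublinear0 ss) add0r.
Qed.

End HahnBanach.

(** * Norming functionals over real and complex scalars *)

Section LinearFunction.
Variables (K : fieldType) (U V : lmodType K) (f : U -> V).
Hypothesis lf : linear f.

Lemma linear_fun0 : f 0 = 0.
Proof. by have := lf (-1) 0 0; rewrite !scaleN1r addr0 oppr0 addNr. Qed.

Lemma linear_funZ a u : f (a *: u) = a *: f u.
Proof. by have := lf a u 0; rewrite linear_fun0 !addr0. Qed.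

Lemma linear_funN u : f (- u) = - f u.
Proof. by rewrite -scaleN1r linear_funZ scaleN1r. Qed.

Lemma linear_funD u v : f (u + v) = f u + f v.
Proof. by have := lf 1 u v; rewrite !scale1r. Qed.

Lemma linear_funB u v : f (u - v) = f u - f v.
Proof. by rewrite linear_funD linear_funN. Qed.

End LinearFunction.

Section RestrictScalars.
Variables (R : realType) (E : lmodType R[i]).

(** A separate name for the carrier, so that the real module structure does not interfere with the
    complex one on [E]. *)
Definition real_restriction : Type := E.

HB.instance Definition _ := GRing.Zmodule.on real_restriction.

Definition real_scale (t : R) (u : real_restriction) : real_restriction :=
  real_complex R t *: (u : E).

Local Lemma real_scaleA a b u : real_scale a (real_scale b u) = real_scale (a * b) u.
Proof. by rewrite /real_scale scalerA rmorphM. Qed.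
Local Lemma real_scale1 : left_id 1 real_scale.
Proof. by move=> u; rewrite /real_scale rmorph1 scale1r. Qed.
Local Lemma real_scaleDr : right_distributive real_scale +%R.
Proof. by move=> a u v; rewrite /real_scale scalerDr. Qed.
Local Lemma real_scaleDl u : {morph real_scale^~ u : a b / a + b}.
Proof. by move=> a b; rewrite /real_scale rmorphD scalerDl. Qed.

HB.instance Definition _ := GRing.Zmodule_isLmodule.Build R real_restriction
  real_scaleA real_scale1 real_scaleDr real_scaleDl.

End RestrictScalars.


Section NormingFunctional.
Variable R : realType.

Lemma rnormN (k : scalars) (V : normedZmodType (scalar_field R k)) (u : V) :
  rnorm (- u) = rnorm u.
Proof. by rewrite /rnorm normrN. Qed.

Lemma rnorm1 (k : scalars) : rnorm (1 : scalar_field R k) = 1.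
Proof. by rewrite /rnorm normr1; case: k. Qed.

Lemma is_norm_ge0 (k : scalars) (E : lmodType (scalar_field R k)) (N : E -> R) u :
  is_norm N -> 0 <= N u.
Proof.
move=> [_ NZ ND]; have N0 : N 0 = 0.
  by have := NZ 0 0; rewrite scale0r rnorm0 mul0r.
have NN : N (- u) = N u by rewrite -scaleN1r NZ rnormN rnorm1 mul1r.
by have := ND u (- u); rewrite subrr N0 NN -mulr2n pmulrn_lge0.
Qed.

Lemma real_norming_functional (E : lmodType (scalar_field R RealScalars))
    (N : E -> R) (v : E) : is_norm N ->
  exists f : E -> (scalar_field R RealScalars)^o,
    [/\ linear f, forall u, rnorm (f u) <= N u & rnorm (f v) = N v].
Proof.
move=> nN; have [_ NZ ND] := nN.
have sN : sublinear (N : (E : lmodType R) -> R).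
  by split=> // t u t0; rewrite NZ /rnorm /= gtr0_norm.
have [f [lf fN fv]] := real_hahn_banach v sN.
exists f; split=> // [u|]; last first.
  by rewrite /rnorm /= fv ger0_norm // is_norm_ge0.
rewrite /rnorm /= ler_norml fN andbT lerNl -(linear_funN lf).
rewrite (le_trans (fN _)) // -[N u]mul1r -(rnorm1 RealScalars).
by rewrite -(rnormN (1 : scalar_field R RealScalars)) -NZ scaleN1r.
Qed.

(* The complex functional with real part [f] is [u |-> f u - i f (i u)]. *)
Lemma complex_norming_functional (E : lmodType R[i]) (N : E -> R) (v : E) :
  (forall u, 0 <= N u) ->
  (forall (a : R[i]) u, N (a *: u) = complex.Re `|a| * N u) ->
  (forall u w, N (u + w) <= N u + N w) ->
  exists f : E -> R[i]^o, [/\ linear f,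
    forall u, complex.Re `|f u| <= N u & complex.Re `|f v| = N v].
Proof.
move=> N0 NZ ND.
have sN : sublinear (N : real_restriction E -> R).
  split; first exact: ND.
  move=> t u t0; rewrite [t *: u]/(real_complex R t *: (u : E)) NZ.
  by rewrite ger0_norm ?lexx // ler0c ltW.
have [f [lf fN fv]] := real_hahn_banach (v : real_restriction E) sN.
pose I : R[i] := Complex 0 1.
pose F (u : E) : R[i]^o := Complex (f u) (- f (I *: u)).
have fD (u w : E) : f (u + w) = f u + f w by exact: linear_funD lf _ _.
(* Since [f] is only real-linear, a complex multiple is split as Re c times u plus Im c times iu. *)
have fC (c : R[i]) (u : E) :
    f (c *: u) = complex.Re c * f u + complex.Im c * f (I *: u).
  have -> : c *: u = complex.Re c *: (u : real_restriction E)
      + complex.Im c *: (I *: u : real_restriction E) :> real_restriction E.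
    transitivity ((real_complex R (complex.Re c)
                   + real_complex R (complex.Im c) * I) *: (u : E)).
      by rewrite mulrC -complexE.
    by rewrite scalerDl -scalerA.
  by rewrite (linear_funD lf) !(linear_funZ lf).
have lF : linear F.
  move=> c u w.
  have IE : I *: (c *: u + w) = (I * c) *: u + I *: w by rewrite scalerDr scalerA.
  rewrite {1}/F IE !fD (fC c) (fC (I * c)).
  apply/eqP; rewrite eq_complex /F; case: c {IE} => c d /=.
  by rewrite !(mul0r, mul1r, add0r, sub0r); apply/andP; split; apply/eqP; ring.
have normR (z : R[i]) : real_complex R (complex.Re `|z|) = `|z|.
  by rewrite RRe_real // normr_real.
have FN u : complex.Re `|F u| <= N u.
  have [->|Fu0] := eqVneq (F u) 0; first by rewrite normr0.
  (* A unimodular factor that rotates F u onto the nonnegative real |F u|. There [F] agrees with its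
     real part [f], which [N] dominates. *)
  pose c := (F u)^-1 * `|F u|.
  have Nc : `|c| = 1 by rewrite normrM normr_id normfV mulVf ?normr_eq0.
  have Fc : F (c *: u) = `|F u|.
    by rewrite (linear_funZ lF) -[LHS]/(c * F u) /c mulrAC mulVf ?mul1r.
  have -> : N u = N (c *: u) by rewrite NZ Nc mul1r.
  by rewrite -Fc; exact: fN.
(* For the reverse inequality, N v = f v is the real part of F v, hence at most |F v|. *)
exists F; split=> //; apply/eqP; rewrite eq_le FN /= -fv.
have := normc_ge_Re (F v); rewrite -normR lecR; apply: le_trans.
exact: ler_norm.
Qed.

Lemma norming_functional (k : scalars) (E : lmodType (scalar_field R k))
    (N : E -> R) (v : E) : is_norm N ->
  exists f : E -> (scalar_field R k)^o,
    [/\ linear f, forall u, rnorm (f u) <= N u & rnorm (f v) = N v].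
Proof.
case: k E N v => E N v nN; first exact: real_norming_functional.
have [_ NZ ND] := nN.
have N0 u : 0 <= N u by exact: is_norm_ge0.
exact: (@complex_norming_functional E N v N0 NZ ND).
Qed.

End NormingFunctional.

(** * Finite p-norms and Hoelder's inequality with exponents in [1, +oo] *)

Section ExtendedInverse.
Variable R : realType.

Lemma inve_fin_ge1 (r : R) : (1 <= r%:E)%E -> (r%:E^-1 = r^-1%:E)%E.
Proof. by rewrite lee_fin => r1; rewrite inver gt_eqF // (lt_le_trans ltr01). Qed.

(** When one exponent in 1/s = 1/p + 1/q is infinite, this identifies s with the other one. *)
Lemma inve_ge1_inj (s p : \bar R) :
  (1 <= s)%E -> (1 <= p)%E -> (s^-1 = p^-1)%E -> s = p.
Proof.
case: s p => [s| |] [p| |] // s1 p1; rewrite ?(inve_fin_ge1 s1) ?(inve_fin_ge1 p1).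
- by move=> [/invr_inj ->].
- by rewrite invey => -[] /eqP; rewrite invr_eq0 gt_eqF // (lt_le_trans ltr01).
- by rewrite invey => -[] /esym/eqP; rewrite invr_eq0 gt_eqF // (lt_le_trans ltr01).
Qed.

End ExtendedInverse.

Section LpNorm.
Variables (R : realType) (k : scalars).
Local Notation K := (scalar_field R k).
Implicit Types (m : nat) (p q s : \bar R).

Definition of_real : R -> K :=
  match k return R -> scalar_field R k with
  | RealScalars => id
  | ComplexScalars => real_complex R
  end.

Lemma rnorm_of_real (t : R) : rnorm (of_real t) = `|t|.
Proof.
rewrite /of_real; case: k => //.
rewrite -[LHS]/(complex.Re `|real_complex R t|) normc_def /=.
by rewrite expr0n addr0 sqrtr_sqr.
Qed.

Lemma le_lp_norm m p (a b : 'I_m -> K) : (1 <= p)%E ->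
  (forall i, rnorm (a i) <= rnorm (b i)) -> lp_norm p a <= lp_norm p b.
Proof.
case: p => [r| |] p1 ab; last 2 first.
- by apply: (le_bigmax2 0 (fun i _ => ab i)).
- by rewrite leeNy_eq in p1.
rewrite /=.
have r0 : 0 <= r by exact: le_trans ler01 p1.
have sum0 (c : 'I_m -> K) : 0 <= \sum_(i < m) rnorm (c i) `^ r.
  by apply: sumr_ge0 => i _; exact: powR_ge0.
apply: ge0_ler_powR; rewrite ?invr_ge0 ?nnegrE //.
by apply: ler_sum => i _; apply: ge0_ler_powR; rewrite ?nnegrE ?rnorm_ge0.
Qed.

Lemma lp_normZ m p (c : K) (a : 'I_m -> K) : (1 <= p)%E ->
  lp_norm p (fun i => c * a i) = rnorm c * lp_norm p a.
Proof.
case: p => [r| |] // p1 /=; last first.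
  rewrite (big_endo (fun x => rnorm c * x)) ?mulr0 //; last first.
    by move=> x y; rewrite maxr_pMr // rnorm_ge0.
  by apply: eq_bigr => i _; rewrite rnormM.
have r0 : r != 0 by rewrite gt_eqF // (lt_le_trans ltr01).
under eq_bigr do rewrite rnormM powRM ?rnorm_ge0 //.
rewrite -mulr_sumr powRM ?powR_ge0 //; last first.
  by apply: sumr_ge0 => i _; exact: powR_ge0.
by rewrite -powRrM divff // powRr1 ?rnorm_ge0.
Qed.

Lemma lp_norm_scale_le m p (c : R) (a b : 'I_m -> K) : (1 <= p)%E -> 0 <= c ->
  (forall i, rnorm (a i) <= c * rnorm (b i)) -> lp_norm p a <= c * lp_norm p b.
Proof.
move=> p1 c0 ab; rewrite -[c]ger0_norm // -rnorm_of_real -lp_normZ //.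
by apply: le_lp_norm => // i; rewrite rnormM rnorm_of_real ger0_norm.
Qed.

Lemma lp_norm_ge0 m p (a : 'I_m -> K) : 0 <= lp_norm p a.
Proof.
case: p => [r| |] //=; first exact: powR_ge0.
by elim/big_ind: _ => // [x y x0 y0|i _]; rewrite ?le_max ?x0 ?rnorm_ge0.
Qed.

Lemma lp_norm_ord1 p (a : 'I_1 -> K) : (1 <= p)%E ->
  lp_norm p a = rnorm (a ord0).
Proof.
case: p => [r| |] // p1 /=; last first.
  by rewrite big_ord_recl big_ord0; apply/max_idPl; exact: rnorm_ge0.
have r0 : r != 0 by rewrite gt_eqF // (lt_le_trans ltr01).
by rewrite big_ord1 -powRrM divff // powRr1 ?rnorm_ge0.
Qed.

(** Divide both families by their norms A and B, and apply Young's inequality to the s-th powers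
    with exponents p/s and q/s, which are conjugate because 1/s = 1/p + 1/q. *)
Lemma lp_norm_hoelder_real m (s p q : R) (a b : 'I_m -> K) :
  0 < s -> 0 < p -> 0 < q -> s^-1 = p^-1 + q^-1 ->
  lp_norm s%:E (fun i => a i * b i) <= lp_norm p%:E a * lp_norm q%:E b.
Proof.
move=> s0 p0 q0 spq /=.
(* The second half settles the case where a norm vanishes, in which dividing by it is impossible. *)
have key (r : R) (c : 'I_m -> K) : 0 < r ->
    let N := lp_norm r%:E c in
    \sum_(i < m) rnorm (c i) `^ r = N `^ r /\
    (N = 0 -> forall i, rnorm (c i) = 0).
  move=> r0 N; have sum0 : 0 <= \sum_(i < m) rnorm (c i) `^ r.
    by apply: sumr_ge0 => i _; exact: powR_ge0.
  have NE : \sum_(i < m) rnorm (c i) `^ r = N `^ r.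
    by rewrite /N /= -powRrM mulVf ?gt_eqF // powRr1.
  split=> // N0 i; move: NE; rewrite N0 powR0 ?gt_eqF // => {}NE.
  exact: powR_eq0_eq0 (psumr_eq0P (fun j _ => powR_ge0 _ _) NE _).
have [] := key p a p0; have [] := key q b q0.
have := lp_norm_ge0 p%:E a; have := lp_norm_ge0 q%:E b => /=.
move: (_ `^ p^-1) (_ `^ q^-1) => A B B0 A0 sumb b0 suma a0.
have zero : (forall i, rnorm (a i * b i) = 0) ->
    (\sum_(i < m) rnorm (a i * b i) `^ s) `^ s^-1 <= A * B.
  move=> ab0; rewrite big1 ?powR0 ?invr_eq0 ?gt_eqF ?mulr_ge0 // => i _.
  by rewrite ab0 powR0 // gt_eqF.
have [Az|AN0] := eqVneq A 0; first by apply: zero => i; rewrite rnormM a0 ?mul0r.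
have [Bz|BN0] := eqVneq B 0; first by apply: zero => i; rewrite rnormM b0 ?mulr0.
have {}A0 : 0 < A by rewrite lt_neqAle eq_sym AN0.
have {}B0 : 0 < B by rewrite lt_neqAle eq_sym BN0.
have AB0 : 0 <= A * B by rewrite mulr_ge0 ?ltW.
suff sum1 : \sum_(i < m) rnorm (a i * b i) `^ s <= (A * B) `^ s.
  rewrite -[leRHS](powRr1 AB0) -(divff (lt0r_neq0 s0)) powRrM.
  apply: ge0_ler_powR; rewrite ?nnegrE ?powR_ge0 ?invr_ge0 ?(ltW s0) //.
  by apply: sumr_ge0 => i _; exact: powR_ge0.
have ps0 : 0 < p / s by rewrite divr_gt0.
have qs0 : 0 < q / s by rewrite divr_gt0.
have pqs1 : (p / s)^-1 + (q / s)^-1 = 1.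
  by rewrite !invf_div -mulrDr -spq divff // gt_eqF.
(* The p-th and q-th powers of the normalised families each sum to 1, so the right-hand side is a
   sum of Young bounds and the comparison becomes termwise. *)
have -> : (A * B) `^ s = \sum_(i < m) (A * B) `^ s *
    ((rnorm (a i) / A) `^ p / (p / s) + (rnorm (b i) / B) `^ q / (q / s)).
  rewrite -mulr_sumr big_split /= -!mulr_suml.
  have norm1 (r D : R) (c : 'I_m -> K) : 0 < D ->
      \sum_(i < m) rnorm (c i) `^ r = D `^ r ->
      \sum_(i < m) (rnorm (c i) / D) `^ r = 1.
    move=> D0 sumc; under eq_bigr do
      rewrite powRM ?rnorm_ge0 ?invr_ge0 ?(ltW D0) //.
    rewrite -mulr_suml sumc -powRM ?invr_ge0 ?ltW //.
    by rewrite divff ?gt_eqF // powR1.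
  by rewrite !norm1 // !mul1r pqs1 mulr1.
apply: ler_sum => i _.
set x := rnorm (a i) / A; set y := rnorm (b i) / B.
have x0 : 0 <= x by rewrite divr_ge0 ?rnorm_ge0 ?ltW.
have y0 : 0 <= y by rewrite divr_ge0 ?rnorm_ge0 ?ltW.
have -> : rnorm (a i * b i) = (A * B) * (x * y).
  by rewrite rnormM mulrACA [A * x]mulrC [B * y]mulrC !divfK.
rewrite (powRM _ AB0 (mulr_ge0 x0 y0)) ler_wpM2l ?powR_ge0 // powRM //.
have := conjugate_powR (powR_ge0 x s) (powR_ge0 y s) ps0 qs0 pqs1.
by rewrite -!powRrM ![s * _]mulrC !divfK // gt_eqF.
Qed.

(** With an infinite exponent, s equals the other exponent and the supremum norm simply factors out.
    With p and q finite, 1/s is positive, so s is finite too. *)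
Lemma lp_norm_hoelder m s p q (a b : 'I_m -> K) :
  (1 <= s)%E -> (1 <= p)%E -> (1 <= q)%E -> (s^-1 = p^-1 + q^-1)%E ->
  lp_norm s (fun i => a i * b i) <= lp_norm p a * lp_norm q b.
Proof.
have sup r (c d : 'I_m -> K) : (1 <= r)%E ->
    lp_norm r (fun i => c i * d i) <= lp_norm +oo%E c * lp_norm r d.
  move=> r1; apply: lp_norm_scale_le => // [|i]; first exact: lp_norm_ge0.
  by rewrite rnormM ler_wpM2r ?rnorm_ge0 //= (le_bigmax _ (fun i => rnorm (c i))).
move=> s1 p1 q1.
case: p p1 => [p| |] // p1; last first.
  by rewrite invey add0e => /(inve_ge1_inj s1 q1) ->; exact: sup.
case: q q1 => [q| |] // q1; last first.
  rewrite invey adde0 => /(inve_ge1_inj s1 p1) ->; rewrite mulrC.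
  by under eq_fun do rewrite mulrC; exact: sup.
have p0 : 0 < p by rewrite (lt_le_trans ltr01).
have q0 : 0 < q by rewrite (lt_le_trans ltr01).
rewrite (inve_fin_ge1 p1) (inve_fin_ge1 q1) -EFinD.
case: s s1 => [s| |] // s1; last first.
  by rewrite invey => -[] /esym/eqP; rewrite gt_eqF // addr_gt0 ?invr_gt0.
rewrite (inve_fin_ge1 s1) => -[spq].
by apply: lp_norm_hoelder_real => //; rewrite (lt_le_trans ltr01).
Qed.

End LpNorm.

(** Subtract 1 = 1/r + 1/p + 1/q from 1/r + 1/s = 1, where s is the conjugate of r. All inverses are
    finite, so this is arithmetic in the reals. *)
Lemma third_exponent_conjugate (R : realType) (p q : \bar R) :
  (1 <= p -> 1 <= q -> p^-1 + q^-1 <= 1 ->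
   1 <= hoelder_conjugate (third_exponent p q) /\
   (hoelder_conjugate (third_exponent p q))^-1 = p^-1 + q^-1)%E.
Proof.
move=> p1 q1 pq; have [r1 rpq] := third_exponentP p1 q1 pq.
set r := third_exponent p q in r1 rpq *.
have s1 := hoelder_conj_ge1 r1; split=> //.
have rN0 : r != 0%E by rewrite gt_eqF // (lt_le_trans lte01).
have := hoelder_conjugate_eq1 (lt_le_trans (ltNyr _) r1) rN0.
move: rpq.
have [? -> _] := Defs.inve_ge1 r1; have [? -> _] := Defs.inve_ge1 s1.
have [? -> _] := Defs.inve_ge1 p1; have [? -> _] := Defs.inve_ge1 q1.
rewrite -!EFinD => -[E1] [E2]; congr EFin; lra.
Qed.

(** * Operator norms and dual norms as real constants *)

Section OperatorNorm.
Variables (R : realType) (k : scalars).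
Local Notation K := (scalar_field R k).

Lemma to_real_eq0 (a : K) : 0 <= a -> to_real a = 0 -> a = 0.
Proof.
case: k a => //= -[r s]; rewrite lecE /= => /andP[/eqP -> _] ->.
by [].
Qed.

Lemma rnorm_is_norm (V : normedModType K) : is_norm (@rnorm R k V).
Proof.
split=> [u|a u|u v]; last exact: rnormD.
  by move=> /(to_real_eq0 (normr_ge0 u))/normr0_eq0.
by rewrite /rnorm normrZ to_realM.
Qed.

Lemma rnorm_scalar_is_norm : is_norm (@rnorm R k K : K^o -> R).
Proof. exact: (rnorm_is_norm K^o). Qed.

Lemma rnorm_eq0 (a : K) : (rnorm a == 0) = (a == 0).
Proof.
have [K0 _ _] := rnorm_scalar_is_norm.
by apply/eqP/eqP => [/K0|->] //; rewrite rnorm0.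
Qed.

Section Bounds.
Variables (E F : lmodType K) (NE : E -> R) (NF : F -> R) (L : E -> F).

Lemma op_norm_le c : 0 <= c -> (forall u, NF (L u) <= c * NE u) ->
  (op_norm NE NF L <= c%:E)%E.
Proof.
move=> c0 Lc; apply: ge_ereal_sup => _ [u /= u1 <-].
by rewrite lee_fin (le_trans (Lc u)) // ler_piMr.
Qed.

(** Boundedness makes the supremum finite, the value at 0 makes it nonnegative, and rescaling [u] to
    norm 1 extends the estimate from the unit ball to all vectors. *)
Lemma op_norm_bound : is_norm NE -> is_norm NF -> linear L ->
  bounded_op NE NF L -> exists c, [/\ op_norm NE NF L = c%:E, 0 <= c
    & forall u, NF (L u) <= c * NE u].
Proof.
move=> nE nF lL [C LC].
have E0 u : 0 <= NE u by exact: is_norm_ge0.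
have F0 u : 0 <= NF u by exact: is_norm_ge0.
(* The constant in [bounded_op] carries no sign, hence the maximum with 0. *)
have ub : (op_norm NE NF L <= (Num.max 0 C)%:E)%E.
  apply: op_norm_le => [|u]; first by rewrite le_max lexx.
  by rewrite (le_trans (LC u)) // ler_wpM2r // le_max lexx orbT.
have NE0 : NE 0 = 0 by case: nE => _ /(_ 0 0); rewrite scale0r rnorm0 mul0r.
have lb : (0 <= op_norm NE NF L)%E.
  apply: le_ereal_sup_tmp; exists (NF (L 0))%:E; last by rewrite lee_fin.
  by exists 0 => //=; rewrite NE0.
have fin : op_norm NE NF L \is a fin_num.
  by rewrite fin_numE -ltey -ltNye (lt_le_trans _ lb) // (le_lt_trans ub) // ltry.
exists (fine (op_norm NE NF L)); rewrite fineK //; split=> // [|u].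
  exact: fine_ge0.
have [NEu|NEu] := eqVneq (NE u) 0.
  by rewrite (le_trans (LC u)) // NEu !mulr0.
have NEu0 : 0 < NE u by rewrite lt_neqAle eq_sym NEu E0.
have rV : rnorm (of_real k (NE u)^-1) = (NE u)^-1.
  by rewrite rnorm_of_real ger0_norm // invr_ge0.
rewrite -ler_pdivrMr // mulrC.
have [_ ZE _] := nE; have [_ ZF _] := nF.
rewrite -lee_fin fineK // -rV -ZF -(linear_funZ lL).
apply: ereal_sup_ubound; exists (of_real k (NE u)^-1 *: u) => //=.
by rewrite ZE rV mulVf.
Qed.

End Bounds.

Section Dual.
Variables (E : lmodType K) (N : E -> R).
Hypothesis nN : is_norm N.
Implicit Types f g : dual N.

Lemma dual_linear f : linear f.
Proof. by have /asboolP[] := dual_subproof f. Qed.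

Lemma dual_bound f : 0 <= dual_norm f /\ forall u, rnorm (f u) <= dual_norm f * N u.
Proof.
have /asboolP[lf bf] := dual_subproof f.
have [c [fc c0 cf]] := op_norm_bound nN rnorm_scalar_is_norm lf bf.
by rewrite /dual_norm fc.
Qed.

Lemma dual_norm_le f c : 0 <= c -> (forall u, rnorm (f u) <= c * N u) ->
  dual_norm f <= c.
Proof.
move=> c0 fc; have /asboolP[lf bf] := dual_subproof f.
have [d [fd d0 df]] := op_norm_bound nN rnorm_scalar_is_norm lf bf.
by rewrite /dual_norm fd /= -lee_fin -fd op_norm_le.
Qed.

Lemma dual_normZ_le a f : dual_norm (a *: f) <= rnorm a * dual_norm f.
Proof.
have [f0 fb] := dual_bound f.
apply: dual_norm_le => [|u]; first by rewrite mulr_ge0 ?rnorm_ge0.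
by rewrite [leLHS]rnormM -mulrA ler_wpM2l ?rnorm_ge0 ?fb.
Qed.

(** The bidual is the dual with respect to [dual_norm], so this makes the estimates for dual spaces
    available one level up. Homogeneity follows from the inequality [dual_normZ_le] applied to a
    scalar and to its inverse. *)
Lemma dual_norm_is_norm : is_norm (@dual_norm R k E N).
Proof.
split=> [f f0|a f|f g].
- apply: val_inj; apply/funext => u; have [_ /(_ u)] := dual_bound f.
  rewrite f0 mul0r => fu.
  by apply/eqP; rewrite -rnorm_eq0 eq_le fu rnorm_ge0.
- apply/eqP; rewrite eq_le dual_normZ_le /=.
  have [->|a0] := eqVneq a 0.
    by rewrite rnorm0 mul0r; exact: (dual_bound _).1.
  have := dual_normZ_le a^-1 (a *: f); rewrite scalerK //.
  have ra0 : rnorm a != 0 by rewrite rnorm_eq0.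
  have -> : rnorm a^-1 = (rnorm a)^-1.
    by apply: (mulIf ra0); rewrite -rnormM !mulVf // rnorm1.
  by rewrite ler_pdivlMl // lt_neqAle rnorm_ge0 andbT eq_sym.
- have [f0 fb] := dual_bound f; have [g0 gb] := dual_bound g.
  apply: dual_norm_le => [|u]; first by rewrite addr_ge0.
  by rewrite mulrDl (le_trans (rnormD _ _)) // lerD ?fb ?gb.
Qed.

End Dual.

Lemma bounded_linear_dual (E : lmodType K) (N : E -> R) (h : E -> K^o) c :
  linear h -> (forall u, rnorm (h u) <= c * N u) ->
  exists f : dual N, forall u, f u = h u.
Proof.
move=> lh hc; have hd : h \in @in_dual R k E N.
  by apply/asboolP; split=> //; exists c.
by exists (Dual hd).
Qed.

End OperatorNorm.

(** * Weak norms tested against forms and bidual functionals *)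

Section Linearization.
Variables (K : fieldType) (n : nat) (X : 'I_n -> lmodType K).
Variables (V W : lmodType K) (L : V -> W) (T : (forall i, X i) -> V).
Hypothesis lL : linear L.

Lemma multilinear_comp : multilinear T -> multilinear (fun x => L (T x)).
Proof. by move=> mT x i a u v; rewrite mT lL. Qed.

Lemma linearize_comp u : linearize (fun x => L (T x)) u = L (linearize T u).
Proof.
rewrite /linearize /formal_eval (big_morph L (linear_funD lL) (linear_fun0 lL)).
by apply: eq_bigr => t _; rewrite (linear_funZ lL).
Qed.

End Linearization.

Lemma linearize_tensB (K : fieldType) (n : nat) (X : 'I_n -> lmodType K)
    (V : lmodType K) (T : (forall i, X i) -> V) (x z : forall i, X i) :
  multilinear T -> linearize T (tens x - tens z) = T x - T z.
Proof.
by move=> mT; rewrite (linear_funB (linearize_linear mT)) !linearize_tens.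
Qed.

Section WeakNorms.
Variables (R : realType) (k : scalars).
Local Notation K := (scalar_field R k).

Lemma scale_linear (a : K) : linear (fun u : K^o => a *: u).
Proof. by move=> b u v; rewrite scalerDr !scalerA mulrC. Qed.

Section Tensor.
Variables (n : nat) (X : 'I_n -> completeNormedModType K) (beta : tensor X -> R).
Variables (p : \bar R).
Hypotheses (nbeta : is_norm beta) (p1 : (1 <= p)%E).

Lemma form_in_ball (phi : (forall i, X i) -> K^o) : multilinear phi ->
  (forall u, rnorm (linearize phi u) <= beta u) ->
  beta_form beta phi /\ (form_norm beta phi <= 1)%E.
Proof.
move=> mphi phi1; split; last by apply: op_norm_le => // u; rewrite mul1r.
by split=> //; exists 1 => u; rewrite mul1r.
Qed.

Lemma weak_tensor_norm_ge0 m (x z : 'I_m -> forall i, X i) :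
  (0 <= weak_tensor_norm beta p x z)%E.
Proof.
have lin0 u : linearize (fun=> 0 : K^o) u = 0 :> K^o.
  by rewrite /linearize /formal_eval big1 // => t _; rewrite scaler0.
apply: le_ereal_sup_tmp.
exists (lp_norm p (fun _ : 'I_m => 0 - 0 : K))%:E; last first.
  by rewrite lee_fin lp_norm_ge0.
exists (fun=> 0) => //; apply: form_in_ball => [y i a u v|u].
  by rewrite scaler0 addr0.
by rewrite lin0 rnorm0 is_norm_ge0.
Qed.

(** For c > 0 the form divided by c competes in the supremum. For c = 0 the form vanishes on all
    differences, and the right-hand side is 0 whatever the weak norm. *)
Lemma form_le_weak_tensor_norm m (x z : 'I_m -> forall i, X i)
    (phi : (forall i, X i) -> K^o) c : multilinear phi -> 0 <= c ->
  (forall u, rnorm (linearize phi u) <= c * beta u) ->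
  ((lp_norm p (fun j => phi (x j) - phi (z j)))%:E
   <= c%:E * weak_tensor_norm beta p x z)%E.
Proof.
move=> mphi; rewrite le_eqVlt => /predU1P[<-|c0] phic.
  rewrite mul0e lee_fin -(mul0r (lp_norm p (fun j => phi (x j) - phi (z j)))).
  apply: lp_norm_scale_le => // j; rewrite mul0r -linearize_tensB //.
  by rewrite (le_trans (phic _)) ?mul0r.
pose psi y : K^o := of_real k c^-1 *: phi y.
have rV : rnorm (of_real k c^-1) = c^-1.
  by rewrite rnorm_of_real ger0_norm // invr_ge0 ltW.
have psi1 : beta_form beta psi /\ (form_norm beta psi <= 1)%E.
  apply: form_in_ball => [|u]; first exact/(multilinear_comp (scale_linear _)).
  rewrite (linearize_comp _ (scale_linear _)) [leLHS]rnormM rV.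
  by rewrite ler_pdivrMl ?phic.
apply: (@le_trans _ _ (c%:E * (lp_norm p (fun j => psi (x j) - psi (z j)))%:E)%E).
  rewrite -EFinM lee_fin; apply: lp_norm_scale_le => // [|j]; first exact: ltW.
  by rewrite -scalerBr [rnorm (_ *: _)]rnormM rV mulrA divff ?mul1r // gt_eqF.
apply: lee_wpmul2l; first by rewrite lee_fin ltW.
by apply: ereal_sup_ubound; exists psi.
Qed.

Lemma weak_tensor_norm_ord1 (x z : 'I_1 -> forall i, X i) :
  (weak_tensor_norm beta p x z
   <= (beta (tens (x ord0) - tens (z ord0)))%:E)%E.
Proof.
apply: ge_ereal_sup => _ [phi [[mphi bphi] phi1] <-].
have [c [phiE c0 phic]] :=
  op_norm_bound nbeta (rnorm_scalar_is_norm R k) (linearize_linear mphi) bphi.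
rewrite lp_norm_ord1 // -linearize_tensB // lee_fin (le_trans (phic _)) //.
rewrite ler_piMl ?is_norm_ge0 //.
by move: phi1; rewrite /form_norm phiE lee_fin.
Qed.

End Tensor.

Section Dual.
Variables (E : lmodType K) (N : E -> R) (q : \bar R).
Hypotheses (nN : is_norm N) (q1 : (1 <= q)%E).

Lemma weak_dual_norm_ge0 m (y : 'I_m -> dual N) : (0 <= weak_dual_norm q y)%E.
Proof.
have nD := dual_norm_is_norm nN.
apply: le_ereal_sup_tmp; exists (lp_norm q (fun _ : 'I_m => 0 : K))%:E; last first.
  by rewrite lee_fin lp_norm_ge0.
exists 0 => //=; have [_ + _] := dual_norm_is_norm nD => /(_ 0 0).
by rewrite scale0r rnorm0 mul0r => ->.
Qed.

(** The same rescaling, now in the bidual. Here [g] is a bare linear function, and its multiple by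
    the inverse of [c] is packaged as an element [h] of the unit ball. *)
Lemma bidual_le_weak_dual_norm m (y : 'I_m -> dual N) (g : dual N -> K^o) c :
  linear g -> 0 <= c -> (forall f, rnorm (g f) <= c * dual_norm f) ->
  ((lp_norm q (fun j => g (y j)))%:E <= c%:E * weak_dual_norm q y)%E.
Proof.
have nD := dual_norm_is_norm nN.
move=> lg; rewrite le_eqVlt => /predU1P[<-|c0] gc.
  rewrite mul0e lee_fin -(mul0r (lp_norm q (fun j => g (y j)))).
  by apply: lp_norm_scale_le => // j; rewrite mul0r (le_trans (gc _)) ?mul0r.
have rV : rnorm (of_real k c^-1) = c^-1.
  by rewrite rnorm_of_real ger0_norm // invr_ge0 ltW.
have [||h hE] := @bounded_linear_dual R k _ (@dual_norm R k E N)
    (fun f => of_real k c^-1 *: g f) 1.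
- by move=> a f f'; rewrite lg scale_linear.
- by move=> f; rewrite [leLHS]rnormM rV mul1r ler_pdivrMl ?gc.
have h1 : dual_norm h <= 1.
  apply: dual_norm_le => // f.
  by rewrite hE [leLHS]rnormM rV mul1r ler_pdivrMl ?gc.
apply: (@le_trans _ _ (c%:E * (lp_norm q (fun j => h (y j)))%:E)%E).
  rewrite -EFinM lee_fin; apply: lp_norm_scale_le => // [|j]; first exact: ltW.
  by rewrite hE [rnorm (_ *: _)]rnormM rV mulrA divff ?mul1r // gt_eqF.
apply: lee_wpmul2l; first by rewrite lee_fin ltW.
by apply: ereal_sup_ubound; exists h.
Qed.

Lemma weak_dual_norm_ord1 (y : 'I_1 -> dual N) : dual_norm (y ord0) <= 1 ->
  (weak_dual_norm q y <= 1)%E.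
Proof.
move=> y1; apply: ge_ereal_sup => _ [g /= g1 <-].
have [g0 gb] := dual_bound (dual_norm_is_norm nN) g.
rewrite lp_norm_ord1 // lee_fin (le_trans (gb _)) //.
by rewrite mulr_ile1 // (dual_bound nN _).1.
Qed.

End Dual.

End WeakNorms.

(** * Rank-one operators and the Lipschitz bound *)

Section Domination.
Variables (R : realType) (k : scalars).
Local Notation K := (scalar_field R k).
Variables (n : nat) (X : 'I_n -> completeNormedModType K).
Variables (Y : completeNormedModType K) (p q : \bar R) (beta : tensor X -> R).
Hypotheses (p1 : (1 <= p)%E) (q1 : (1 <= q)%E) (pq : (p^-1 + q^-1 <= 1)%E).
Hypothesis nbeta : is_norm beta.

Local Notation s := (hoelder_conjugate (third_exponent p q)).

(** A domination constant must be positive, whereas products of norms may be 0; hence the extra [e],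
    which [domination_norm_le] lets tend to 0. *)
Lemma domination_constW (T : (forall i, X i) -> Y) c e : 0 <= c -> 0 < e ->
  (forall m (x z : 'I_m -> forall i, X i) (y : 'I_m -> dual (@rnorm R k Y)),
    ((lp_norm s (fun j => y j (T (x j) - T (z j))))%:E
     <= c%:E * weak_tensor_norm beta p x z * weak_dual_norm q y)%E) ->
  domination_const p q beta T (c + e).
Proof.
move=> c0 e0 Tc; split; first by rewrite ltr_wpDl.
move=> m x z y; apply: (le_trans (Tc m x z y)).
apply: lee_wpmul2r; first exact/weak_dual_norm_ge0/rnorm_is_norm.
apply: lee_wpmul2r; first exact: weak_tensor_norm_ge0.
by rewrite lee_fin lerDl ltW.
Qed.

Lemma domination_norm_le (T : (forall i, X i) -> Y) c : 0 <= c ->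
  (forall m (x z : 'I_m -> forall i, X i) (y : 'I_m -> dual (@rnorm R k Y)),
    ((lp_norm s (fun j => y j (T (x j) - T (z j))))%:E
     <= c%:E * weak_tensor_norm beta p x z * weak_dual_norm q y)%E) ->
  (domination_norm p q beta T <= c%:E)%E.
Proof.
move=> c0 Tc; apply/lee_addgt0Pr => e e0.
by apply: ereal_inf_lbound; exists (c + e) => //; exact: domination_constW.
Qed.

Lemma domination_norm_form (phi : (forall i, X i) -> K^o) (y : Y) :
  beta_form beta phi ->
  (domination_norm p q beta (fun x => phi x *: y)
   <= form_norm beta phi * (rnorm y)%:E)%E.
Proof.
move=> [mphi bphi]; have [s1 spq] := third_exponent_conjugate p1 q1 pq.
have [c [phiE c0 phic]] :=
  op_norm_bound nbeta (rnorm_scalar_is_norm R k) (linearize_linear mphi) bphi.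
rewrite /form_norm phiE -EFinM.
apply: domination_norm_le => [|m x z f]; first by rewrite mulr_ge0 ?rnorm_ge0.
(* The factorisation to which Hoelder's inequality applies. *)
have -> : (fun j => f j (phi (x j) *: y - phi (z j) *: y)) =
          (fun j => (phi (x j) - phi (z j)) * f j y).
  by apply/funext => j; rewrite -scalerBl (linear_funZ (dual_linear _)).
apply: (@le_trans _ _ ((lp_norm p (fun j => phi (x j) - phi (z j)))%:E
                       * (lp_norm q (fun j => f j y))%:E)%E).
  by rewrite -EFinM lee_fin lp_norm_hoelder.
rewrite EFinM -[leRHS]muleA muleACA.
apply: lee_pmul; rewrite ?lee_fin ?lp_norm_ge0 //.
  exact: form_le_weak_tensor_norm.
have nY := rnorm_is_norm Y.
(* Evaluation at [y] is the canonical image of [y] in the bidual, bounded by the norm of [y]. *)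
apply: (bidual_le_weak_dual_norm nY q1 f (g := fun h => h y)).
- by [].
- exact: rnorm_ge0.
- by move=> h; rewrite mulrC (dual_bound nY h).2.
Qed.

Lemma lipschitz_const_le_domination_norm (T : (forall i, X i) -> Y) :
  dominated p q beta T ->
  (lipschitz_const beta (linearize T) <= domination_norm p q beta T)%E.
Proof.
move=> [mT _]; have [s1 _] := third_exponent_conjugate p1 q1 pq.
have nY := rnorm_is_norm Y.
(* The infima compare because every domination constant is itself a Lipschitz constant. *)
apply: ereal_inf_le_tmp => _ [C [C0 TC] <-]; exists C => //; split; first exact: ltW.
move=> _ _ [x _ <-] [z _ <-]; rewrite !linearize_tens //.
have [h [lh hb hT]] := norming_functional (T x - T z) nY.
have [|f fE] := @bounded_linear_dual R k Y (@rnorm R k Y) h 1 lh.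
  by move=> u; rewrite mul1r.
have f1 : dual_norm f <= 1.
  by apply: (dual_norm_le nY) => // u; rewrite fE mul1r.
have := TC 1 (fun=> x) (fun=> z) (fun=> f).
rewrite lp_norm_ord1 // fE hT -lee_fin => /le_trans; apply.
rewrite -[leRHS]mule1 EFinM.
apply: lee_pmul.
- by rewrite mule_ge0 ?lee_fin ?(ltW C0) // weak_tensor_norm_ge0.
- exact: weak_dual_norm_ge0.
- apply: lee_wpmul2l; first by rewrite lee_fin ltW.
  exact: (weak_tensor_norm_ord1 nbeta p1 (fun=> x) (fun=> z)).
- exact: weak_dual_norm_ord1.
Qed.

End Domination.

(** * The ideal property under composition *)

Section Ideal.
Variables (R : realType) (k : scalars).
Local Notation K := (scalar_field R k).
Variables (p q : \bar R) (n : nat) (X Z : 'I_n -> completeNormedModType K).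
Variables (Y W : completeNormedModType K).
Variables (beta : tensor X -> R) (theta : tensor Z -> R).
Variables (A : (forall i, Z i) -> tensor X) (S : {linear Y -> W}).
Hypotheses (p1 : (1 <= p)%E) (q1 : (1 <= q)%E).
Hypotheses (nbeta : is_norm beta) (ntheta : is_norm theta).
Hypothesis mA : multilinear A.

Section Constants.
Variables a b : R.
Hypotheses (a0 : 0 <= a) (b0 : 0 <= b).
Hypothesis Aa : forall u, beta (linearize A u) <= a * theta u.
Hypothesis Sb : forall y, rnorm (S y) <= b * rnorm y.

(** Composing a form of the unit ball on X with the linearization of [A] gives a form on Z of norm
    at most [a], with the same values along the families. *)
Lemma weak_tensor_norm_comp m (x x' : 'I_m -> forall i, X i)
    (z z' : 'I_m -> forall i, Z i) :
  (forall j, A (z j) = tens (x j)) -> (forall j, A (z' j) = tens (x' j)) ->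
  (weak_tensor_norm beta p x x' <= a%:E * weak_tensor_norm theta p z z')%E.
Proof.
move=> Az Az'; apply: ge_ereal_sup => _ [phi [[mphi bphi] phi1] <-].
have lphi := linearize_linear mphi.
have [c [phiE c0 phic]] :=
  op_norm_bound nbeta (rnorm_scalar_is_norm R k) lphi bphi.
have c1 : c <= 1 by move: phi1; rewrite /form_norm phiE lee_fin.
have -> : (fun j => phi (x j) - phi (x' j)) =
    (fun j => linearize phi (A (z j)) - linearize phi (A (z' j))).
  by apply/funext => j; rewrite Az Az' !linearize_tens.
apply: (form_le_weak_tensor_norm p1 z z'
         (phi := fun w => linearize phi (A w))) => //.
  exact: (multilinear_comp lphi).
move=> u; rewrite linearize_comp // (le_trans (phic _)) //.
by rewrite (le_trans _ (Aa u)) // ler_piMl ?is_norm_ge0.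
Qed.

Lemma exists_adjoint : exists adj : dual (@rnorm R k W) -> dual (@rnorm R k Y),
  forall h v, adj h v = h (S v).
Proof.
have nW := rnorm_is_norm W.
suff /choice[adj adjE] : forall h : dual (@rnorm R k W),
    exists f : dual (@rnorm R k Y), forall v, f v = h (S v) by exists adj.
move=> h; have [h0 hb] := dual_bound nW h.
apply: (@bounded_linear_dual R k Y (@rnorm R k Y) _ (dual_norm h * b)) => [c u v|v].
  by rewrite linearP (dual_linear h).
by rewrite -mulrA (le_trans (hb _)) // ler_wpM2l.
Qed.

(** The family [y] is the image of [w] under the adjoint of [S]. A bidual functional in the unit
    ball, composed with that adjoint, has norm at most [b]. *)
Lemma weak_dual_norm_comp m (y : 'I_m -> dual (@rnorm R k Y))
    (w : 'I_m -> dual (@rnorm R k W)) :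
  (forall j v, y j v = w j (S v)) ->
  (weak_dual_norm q y <= b%:E * weak_dual_norm q w)%E.
Proof.
have nY := rnorm_is_norm Y; have nW := rnorm_is_norm W.
move=> yw.
have [adj adjE] := exists_adjoint.
have ladj : linear adj.
  move=> c h h'; apply: val_inj; apply/funext => v.
  transitivity (c *: adj h v + adj h' v); last by [].
  by rewrite [LHS]adjE !adjE.
apply: ge_ereal_sup => _ [g /= g1 <-].
have [g0 gb] := dual_bound (dual_norm_is_norm nY) g.
have -> : (fun j => g (y j)) = (fun j => g (adj (w j))).
  apply/funext => j; congr (g _); apply: val_inj; apply/funext => v /=.
  by rewrite adjE yw.
apply: (bidual_le_weak_dual_norm nW q1 w (g := fun h => g (adj h))) => //.
  by move=> c h h'; rewrite ladj (dual_linear g).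
move=> h; have [h0 hb] := dual_bound nW h.
rewrite (le_trans (gb _)) // (@le_trans _ _ (dual_norm (adj h))) //.
  by rewrite ler_piMl // (dual_bound nY _).1.
apply: (dual_norm_le nY) => [|v]; first by rewrite mulr_ge0.
by rewrite adjE (le_trans (hb _)) // [b * _]mulrC -mulrA ler_wpM2l.
Qed.

Hypothesis decA : linearize A @` decomposable Z `<=` decomposable X.

Lemma domination_comp (T : (forall i, X i) -> Y) C : multilinear T ->
  domination_const p q beta T C ->
  forall m (z z' : 'I_m -> forall i, Z i) (w : 'I_m -> dual (@rnorm R k W)),
  ((lp_norm (hoelder_conjugate (third_exponent p q))
      (fun j => w j (S (linearize T (A (z j))) - S (linearize T (A (z' j))))))%:E
   <= (a * b * C)%:E * weak_tensor_norm theta p z z' * weak_dual_norm q w)%E.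
Proof.
move=> mT [C0 TC] m z z' w.
have nY := rnorm_is_norm Y; have nW := rnorm_is_norm W.
(* The vectors [x] representing an elementary tensor are not unique, but [T x] is the value of the
   linearization at that tensor, so any choice serves. *)
have Adec v : exists x, A v = tens x.
  have [x _ xE] : decomposable X (linearize A (tens v)).
    by apply: decA; exists (tens v) => //; exists v.
  by exists x; rewrite xE linearize_tens.
have /choice[x xE] := fun j => Adec (z j).
have /choice[x' xE'] := fun j => Adec (z' j).
have [adj adjE] := exists_adjoint.
have yE j v : adj (w j) v = w j (S v) by exact: adjE.
have -> : (fun j => w j (S (linearize T (A (z j))) - S (linearize T (A (z' j))))) =
    (fun j => adj (w j) (T (x j) - T (x' j))).
  by apply/funext => j; rewrite yE xE xE' !linearize_tens // linearB.
apply: (le_trans (TC m x x' (adj \o w))).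
have wt := weak_tensor_norm_comp xE xE'.
have wd := weak_dual_norm_comp (y := adj \o w) yE.
have t0 : (0 <= weak_tensor_norm beta p x x')%E by exact: weak_tensor_norm_ge0.
have d0 : (0 <= weak_dual_norm q (adj \o w))%E by exact: weak_dual_norm_ge0.
have CE : (0 <= C%:E)%E by rewrite lee_fin ltW.
apply: (@le_trans _ _ (C%:E * (a%:E * weak_tensor_norm theta p z z')
                       * (b%:E * weak_dual_norm q w))%E).
  by apply: lee_pmul => //; [exact: mule_ge0 | exact: lee_wpmul2l].
by rewrite (muleCA C%:E) muleACA !EFinM !muleA.
Qed.

End Constants.

Lemma dominated_comp (T : (forall i, X i) -> Y) :
  bounded_op theta beta (linearize A) ->
  linearize A @` decomposable Z `<=` decomposable X ->
  dominated p q beta T ->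
  bounded_op (@rnorm R k Y) (@rnorm R k W) S ->
  dominated p q theta (fun z => S (linearize T (A z))) /\
  (domination_norm p q theta (fun z => S (linearize T (A z)))
   <= op_norm theta beta (linearize A) * domination_norm p q beta T
      * op_norm (@rnorm R k Y) (@rnorm R k W) S)%E.
Proof.
move=> bA decA [mT [C0 TC0]] bS; have lin_S : linear S by exact: linearP.
have [a [-> a0 Aa]] := op_norm_bound ntheta nbeta (linearize_linear mA) bA.
have [b [-> b0 Sb]] := op_norm_bound (rnorm_is_norm Y) (rnorm_is_norm W) lin_S bS.
have ab0 : 0 <= a * b by rewrite mulr_ge0.
have comp C := domination_comp a0 b0 Aa Sb decA mT (C := C).
split.
  split.
    exact: multilinear_comp lin_S (multilinear_comp (linearize_linear mT) mA).
  exists (a * b * C0 + 1); apply: domination_constW (comp _ TC0) => //.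
  by rewrite mulr_ge0 // ltW // TC0.1.
have le C : domination_const p q beta T C ->
    (domination_norm p q theta (fun z => S (linearize T (A z))) <= (a * b * C)%:E)%E.
  move=> TC; apply: domination_norm_le (comp _ TC) => //.
  by rewrite mulr_ge0 // ltW // TC.1.
rewrite muleAC -EFinM.
(* Only a positive factor is moved through the infimum. If [a * b] is 0, the single constant [C0]
   already bounds the norm by 0. *)
move: ab0; rewrite le_eqVlt => /predU1P[ab0|ab0].
  by have := le _ TC0; rewrite -ab0 mul0r mul0e.
rewrite -ereal_inf_pZl //; apply: le_ereal_inf_tmp => _ [_ [C TC <-] <-].
by rewrite -EFinM le.
Qed.

End Ideal.

Theorem proposition4p5 (R : realType) (k : scalars) (p q : \bar R)
    (n : nat) (X : 'I_n -> completeNormedModType (scalar_field R k))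
    (Y : completeNormedModType (scalar_field R k)) (beta : tensor X -> R) :
  (0 < n)%N ->
  (1 <= p)%E -> (1 <= q)%E -> (p^-1 + q^-1 <= 1)%E ->
  reasonable_crossnorm beta ->
  [/\ forall (phi : (forall i, X i) -> (scalar_field R k)^o) (y : Y),
        beta_form beta phi ->
        (domination_norm p q beta (fun x => phi x *: y)
         <= form_norm beta phi * (rnorm y)%:E)%E,
      forall T : (forall i, X i) -> Y,
        dominated p q beta T ->
        (lipschitz_const beta (linearize T) <= domination_norm p q beta T)%E
    & forall (Z : 'I_n -> completeNormedModType (scalar_field R k))
        (W : completeNormedModType (scalar_field R k)) (theta : tensor Z -> R)
        (A : (forall i, Z i) -> tensor X) (T : (forall i, X i) -> Y)
        (S : {linear Y -> W}),
        reasonable_crossnorm theta ->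
        bounded_multilinear beta A ->
        bounded_op theta beta (linearize A) ->
        linearize A @` decomposable Z `<=` decomposable X ->
        dominated p q beta T ->
        bounded_op (@rnorm R k Y) (@rnorm R k W) S ->
        dominated p q theta (fun z => S (linearize T (A z))) /\
        (domination_norm p q theta (fun z => S (linearize T (A z)))
         <= op_norm theta beta (linearize A) * domination_norm p q beta T
            * op_norm (@rnorm R k Y) (@rnorm R k W) S)%E].
Proof.
move=> _ p1 q1 pq [nbeta _]; split.
- by move=> phi y; exact: domination_norm_form.
- by move=> T; exact: lipschitz_const_le_domination_norm.
- move=> Z W theta A T S [ntheta _] [mA _]; exact: dominated_comp.
Qed.
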